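(* Let $n=2$, $\varepsilon>0$, and consider the Cauchy initial value problem $$\partial_tA=\Delta A-\varepsilon^{-2}A(A^tA-I_2),\qquad A(0,x)=A_0(x)\in SO(2),\qquad x\in\Omega,\ t\ge0,$$ for a $2\times2$ matrix-valued field $A(t,x)$. Write the solution as $A(t,x)=[\vec u_1(t,x),\vec u_2(t,x)]$, where $\vec u_1(t,x)$ and $\vec u_2(t,x)$ are the two column vectors. Then $\vec u_1(t,x)$ satisfies the complex Ginzburg–Landau equation $$\partial_t\vec u_1(t,x)=\Delta\vec u_1(t,x)-\varepsilon^{-2}\vec u_1\left(|\vec u_1|^2-1\right),\qquad x\in\Omega,\ t\ge0.$$
   Context: $\Omega$ is a flat torus or, more generally, a closed Riemannian manifold, and $\Delta$ acts entrywise. $SO(2)$ is the group of $2\times2$ real orthogonal matrices with determinant $1$, and $|\cdot|$ is the Euclidean norm on $\mathbb R^2$. *)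

(* Defs.v *)
From HB Require Import structures.
From mathcomp Require Import all_boot all_order all_algebra.
From mathcomp Require Import all_classical all_reals.
From mathcomp Require Import topology normedtype derive.
Set Implicit Arguments.
Unset Strict Implicit.
Unset Printing Implicit Defensive.
Import Order.TTheory GRing.Theory Num.Theory.
Import numFieldNormedType.Exports.
Local Open Scope classical_set_scope.
Local Open Scope ring_scope.

(* C^k on U; meant for U open, where pointwise and relative continuity agree. *)
Fixpoint Ck (R : realType) (d : nat) (k : nat) (U : set 'rV[R]_d)
    (f : 'rV[R]_d -> R) : Prop :=
  (forall x, U x -> {for x, continuous f}) /\
  match k with
  | 0%N => True
  | k'.+1 => forall i : 'I_d, (forall x, U x -> derivable f x 'e_i) /\
                              Ck k' U (fun x => 'D_'e_i f x)
  end.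

Definition smooth_on (R : realType) (d : nat) (U : set 'rV[R]_d)
    (f : 'rV[R]_d -> R) : Prop :=
  forall k, Ck k U f.

(* A compact boundaryless smooth manifold with a Riemannian metric, presented by
   an atlas.  The values of [chart a] outside [chart_dom a], and of [chart_inv a]
   and [metric a] outside the image of that domain, are irrelevant.  Second
   countability is automatic (compact and locally Euclidean).  The matrix
   [metric a x] has entries g_ij(x) in the chart [a]; as vectors are rows and
   v *m 'J f x is the differential of f at x applied to v, the change-of-chart
   rule reads g_a = J g_b J^T. *)
Record closedRiemannianManifold (R : realType) (d : nat) := {
  carrier :> topologicalType;
  carrier_hausdorff : hausdorff_space carrier;
  carrier_compact : compact [set: carrier];
  chart_index : Type;
  chart_dom : chart_index -> set carrier;
  chart : chart_index -> carrier -> 'rV[R]_d;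
  chart_inv : chart_index -> 'rV[R]_d -> carrier;
  chart_at : carrier -> chart_index;
  chart_atP : forall p, chart_dom (chart_at p) p;
  chart_dom_open : forall a, open (chart_dom a);
  chart_cod_open : forall a, open (chart a @` chart_dom a);
  chartK : forall a p, chart_dom a p -> chart_inv a (chart a p) = p;
  chart_continuous : forall a p, chart_dom a p ->
    {for p, continuous (chart a)};
  chart_inv_continuous : forall a x, (chart a @` chart_dom a) x ->
    {for x, continuous (chart_inv a)};
  transition_smooth : forall a b (i : 'I_d),
    smooth_on (chart a @` (chart_dom a `&` chart_dom b))
              (fun x => chart b (chart_inv a x) 0 i);
  metric : chart_index -> 'rV[R]_d -> 'M[R]_d;
  metric_smooth : forall a (i j : 'I_d),
    smooth_on (chart a @` chart_dom a) (fun x => metric a x i j);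
  metric_symmetric : forall a x, (chart a @` chart_dom a) x ->
    (metric a x)^T = metric a x;
  metric_posdef : forall a x, (chart a @` chart_dom a) x ->
    forall v : 'rV[R]_d, v != 0 -> 0 < (v *m metric a x *m v^T) 0 0;
  metric_transition : forall a b x,
    (chart a @` (chart_dom a `&` chart_dom b)) x ->
    let phi := fun y => chart b (chart_inv a y) in
    metric a x = 'J phi x *m metric b (phi x) *m ('J phi x)^T
}.

Definition C2 (R : realType) (d : nat) (M : closedRiemannianManifold R d)
    (f : M -> R) : Prop :=
  forall a : chart_index M,
    Ck 2 (chart a @` chart_dom a) (fun x => f (chart_inv a x)).

(* Local formula |g|^(-1/2) \sum_i d_i (|g|^(1/2) \sum_j g^ij d_j f). *)
Definition chart_laplacian (R : realType) (d : nat)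
    (M : closedRiemannianManifold R d) (a : chart_index M) (f : M -> R)
    (x : 'rV[R]_d) : R :=
  let vol := fun y => Num.sqrt (\det (metric a y)) in
  let flux := fun (i : 'I_d) (y : 'rV[R]_d) =>
    vol y * \sum_(j < d) invmx (metric a y) i j *
                         'D_'e_j (fun z => f (chart_inv a z)) y : R in
  (vol x)^-1 * \sum_(i < d) 'D_'e_i (flux i) x.

(* For f of class C^2 the value does not depend on the chart around p. *)
Definition laplacian (R : realType) (d : nat)
    (M : closedRiemannianManifold R d) (f : M -> R) (p : M) : R :=
  chart_laplacian (chart_at p) f (chart (chart_at p) p).

Definition mx_laplacian (R : realType) (d : nat)
    (M : closedRiemannianManifold R d) (m n : nat) (u : M -> 'M[R]_(m, n))
    (p : M) : 'M[R]_(m, n) :=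
  \matrix_(i, j) laplacian (fun q => u q i j) p.

(* Derivative at t of a curve on [0, +oo[: two-sided for t > 0, right derivative
   at t = 0. *)
Definition is_time_derivative (R : realType) (m n : nat)
    (u : R -> 'M[R]_(m, n)) (t : R) (l : 'M[R]_(m, n)) : Prop :=
  (fun h => h^-1 *: (u (t + h) - u t)) @ within [set h | 0 <= t + h] 0^' --> l.

(* Classical solutions of d_t u = Delta u + F(u): continuous on [0, +oo[ x M,
   the equation being required at the times t in I.  Values at t < 0 are
   irrelevant. *)
Definition classical_solution (R : realType) (d : nat)
    (M : closedRiemannianManifold R d) (m n : nat) (I : set R)
    (F : 'M[R]_(m, n) -> 'M[R]_(m, n)) (u : R -> M -> 'M[R]_(m, n)) : Prop :=
  [/\ {within [set z : R * M | 0 <= z.1], continuous (fun z => u z.1 z.2)},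
      forall t, I t -> forall i j, C2 (fun p : M => u t p i j) &
      forall t p, I t ->
        is_time_derivative (fun s => u s p) t
          (mx_laplacian (u t) p + F (u t p))].

Definition SO (R : realType) (n : nat) : set 'M[R]_n :=
  [set A | A^T *m A = 1%:M /\ \det A = 1].

(* The library norm on matrices is the sup norm, hence this one. *)
Definition enorm (R : realType) (n : nat) (v : 'cV[R]_n) : R :=
  Num.sqrt (\sum_(i < n) v i 0 ^+ 2).

Definition mx_reaction (R : realType) (n : nat) (eps : R) (A : 'M[R]_n) :
    'M[R]_n :=
  - (eps ^- 2 *: (A *m (A^T *m A - 1%:M))).

(* For n = 2, with R^2 identified with the complex plane, the complex
   Ginzburg-Landau nonlinearity. *)
Definition GL_reaction (R : realType) (n : nat) (eps : R) (v : 'cV[R]_n) :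
    'cV[R]_n :=
  - (eps ^- 2 *: ((enorm v ^+ 2 - 1) *: v)).

(* Main.v *)
Require Import Defs.
From HB Require Import structures.
From mathcomp Require Import all_boot all_order all_algebra.
From mathcomp Require Import all_classical all_reals.
From mathcomp Require Import topology normedtype derive.
From mathcomp Require Import landau sequences realfun exp.
From mathcomp Require Import ring lra.
Set Implicit Arguments.
Unset Strict Implicit.
Unset Printing Implicit Defensive.
Import Order.TTheory GRing.Theory Num.Theory.
Import numFieldNormedType.Exports.
Local Open Scope classical_set_scope.
Local Open Scope ring_scope.

(* Acting on R^2 = C, a real 2x2 matrix is v |-> z v + w (conj v), and it is
   conformal exactly when w = 0.  The anticonformal part of A A^T A is
   (|w|^2 + 3|z|^2) w, so both real components of w solve a linear scalar
   equation d_t w = Delta w + q w with q <= eps^-2.  They vanish at time 0, hence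
   forever by the parabolic maximum principle.  Since A stays conformal,
   A^T A = |u_1|^2 I and the first column of the equation is Ginzburg-Landau. *)

(** * Functions of class C^k *)

Section Calculus.
Variable R : realType.

Lemma is_derive_line (V W : normedModType R) (f : V -> W) (x v : V) (s : R) :
  derivable f (x + s *: v) v ->
  is_derive s 1 (fun r => f (x + r *: v)) ('D_v f (x + s *: v)).
Proof.
have E : (fun h : R => h^-1 *: (((fun r => f (x + r *: v)) \o shift s) (h *: 1) -
    (fun r => f (x + r *: v)) s)) =
  (fun h : R => h^-1 *: ((f \o shift (x + s *: v)) (h *: v) - f (x + s *: v))).
  apply/funext => h /=; congr (_ *: (f _ - _)).
  by rewrite [h *: 1]mulr1 scalerDl addrCA.
by move=> df; apply: DeriveDef; rewrite /derivable /derive E.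
Qed.

(** Mean value theorem between 0 and [a]. Both signs of [a] are allowed, since [a] will be a
    coordinate of an arbitrary increment. *)
Lemma affine_approx_bound (g dg : R -> R) (a c e : R) :
  (forall s : R, `|s| <= `|a| -> is_derive (s : R) 1 g (dg s)) ->
  (forall s : R, `|s| <= `|a| -> `|dg s - c| <= e) ->
  `|g a - g 0 - a * c| <= e * `|a|.
Proof.
move=> g_der dg_near.
(* [[l, r]] is the segment between 0 and [a] with its ends in order; the last clause carries the
   mean value identity back to [a] whatever its sign. *)
have [l [r [lr in_lr gE]]] : exists l r : R, [/\ l <= r,
    forall s, s \in `[l, r]%R -> `|s| <= `|a| &
    forall c, g r - g l = c * (r - l) -> g a - g 0 = c * a].
  have [a0|a0] := leP 0 a.
    exists 0, a; split => // [s|k ->]; last by rewrite subr0.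
    by rewrite in_itv/= => /andP[s0 sa]; rewrite !ger0_norm.
  exists a, 0; split=> [|s|k E]; first exact: ltW.
    by rewrite in_itv/= => /andP[s0 sa]; rewrite !ler0_norm ?lerN2// ltW.
  by rewrite -opprB E; ring.
have [s|| s /in_lr s_le /gE ->] := @MVT_segment _ g dg l r lr.
- by move=> /subset_itv_oo_cc/in_lr/g_der.
- by apply: derivable_within_continuous => s /in_lr/g_der [].
by rewrite mulrC -mulrBr normrM mulrC ler_wpM2r// dg_near.
Qed.

Lemma near_forall_norm (V : normedModType R) (I : finType) (P : I -> V -> Prop)
    (x : V) :
  (forall i, \forall y \near x, P i y) ->
  exists2 r : R, 0 < r & forall i y, `|y - x| < r -> P i y.
Proof.
move=> /(@filter_forall _ _ _ _ (nbhs_filter x))/nbhs_normP[r /= r0 xr].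
by exists r => // i y yx; apply: xr; rewrite /= distrC.
Qed.

Lemma coord_le_norm m n (x : 'M[R]_(m, n)) i j : `|x i j| <= `|x|.
Proof.
by rewrite [leRHS]/Num.norm /= mx_normrE; apply/bigmax_geP; right; exists (i, j).
Qed.

Lemma near_eq_continuous (T T' : topologicalType) (f g : T -> T') (x : T) :
  (\near x, f x = g x) -> {for x, continuous f} -> {for x, continuous g}.
Proof.
move=> fg; rewrite /prop_for /continuous_at -(nbhs_singleton fg) => cf.
by apply: cvg_trans cf; apply: near_eq_cvg.
Qed.

Variable d : nat.
Implicit Types (f g : 'rV[R]_d -> R) (U : set 'rV[R]_d) (x v : 'rV[R]_d).

(** For [k] from 0 to [d] these are the vertices of a path from 0 to [h] with edges parallel to the
    axes. *)
Definition row_trunc (k : nat) (h : 'rV[R]_d) : 'rV[R]_d :=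
  \row_j (if (j < k)%N then h 0 j else 0).

Lemma row_truncS (h : 'rV[R]_d) (i : 'I_d) :
  row_trunc i.+1 h = row_trunc i h + h 0 i *: 'e_i.
Proof.
apply/rowP => j; rewrite !mxE eqxx/= ltnS leq_eqVlt -val_eqE /=.
by have [ji|ji|/val_inj->] := ltngtP; rewrite ?mulr0 ?addr0// mulr1 add0r.
Qed.

(* The increment is split along the coordinate axes, and the mean value theorem
   is applied to each piece. *)
Lemma partial_increment_bound f x (e r : R) :
  (forall (i : 'I_d) y, `|y - x| < r -> derivable f y 'e_i /\
     `|'D_'e_i f y - 'D_'e_i f x| <= e) ->
  forall h, `|h| < r ->
  `|f (x + h) - f x - \sum_i h 0 i * 'D_'e_i f x| <= (e * d%:R) * `|h|.
Proof.
move=> near_x h hr.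
have tele : f (x + h) - f x =
    \sum_(i < d) (f (x + row_trunc i.+1 h) - f (x + row_trunc i h)).
  rewrite -(big_mkord xpredT
    (fun i => f (x + row_trunc i.+1 h) - f (x + row_trunc i h))).
  rewrite telescope_sumr//; congr (f (x + _) - f _).
    by apply/rowP => j; rewrite mxE ltn_ord.
  by rewrite -[LHS]addr0; congr (_ + _); apply/rowP => j; rewrite !mxE.
rewrite tele -sumrB; apply: (le_trans (ler_norm_sum _ _ _)).
have -> : e * d%:R * `|h| = \sum_(i < d) (e * `|h|).
  by rewrite sumr_const card_ord -mulr_natr; ring.
apply: ler_sum => i _.
(* Each coordinate of a point of the path is bounded by that of [h], so in the sup norm the path
   stays in the ball. *)
have seg s : `|s| <= `|h 0 i| -> `|x + row_trunc i h + s *: 'e_i - x| < r.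
  move=> sh; apply: le_lt_trans hr.
  rewrite addrAC [x + _]addrC addrK [leLHS]/Num.norm/= mx_normrE.
  apply/bigmax_leP; split => //= -[a j] _ /=; rewrite ord1 !mxE eqxx/=.
  have := coord_le_norm h 0 j; case: (ltngtP j i) => [ji|ji|/val_inj->].
  - by rewrite -val_eqE/= ltn_eqF// mulr0 addr0.
  - by rewrite -val_eqE/= gtn_eqF// mulr0 addr0 normr0.
  - by rewrite eqxx mulr1 add0r; exact: le_trans.
(* The sign of [e] is read off the hypothesis at [y = x]; it serves to pass from a coordinate of [h]
   to its norm. *)
have e0 : 0 <= e.
  have [_] : derivable f x 'e_i /\ `|'D_'e_i f x - 'D_'e_i f x| <= e.
    by apply: near_x; rewrite subrr normr0; exact: le_lt_trans hr.
  by rewrite subrr normr0.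
apply: (@le_trans _ _ (e * `|h 0 i|)); last by rewrite ler_wpM2l// coord_le_norm.
have := @affine_approx_bound (fun s => f (x + row_trunc i h + s *: 'e_i))
  (fun s => 'D_'e_i f (x + row_trunc i h + s *: 'e_i)) (h 0 i) ('D_'e_i f x) e.
rewrite scale0r addr0 row_truncS addrA; apply=> s sh.
  by apply: is_derive_line; have [] := near_x i _ (seg _ sh).
by have [] := near_x i _ (seg _ sh).
Qed.

(** On a small enough ball the increment bound holds with [e] as small as desired, so the linear map
    built from the partial derivatives is the total differential. *)
Lemma differentiable_partial f x :
  (forall i : 'I_d, \forall y \near x, derivable f y 'e_i) ->
  (forall i : 'I_d, {for x, continuous ('D_'e_i f)}) ->
  differentiable f x.
Proof.
move=> df cdf.
pose L (h : 'rV[R]_d) : R := \sum_i h 0 i * 'D_'e_i f x.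
have L_linear : linear L.
  move=> a u v; rewrite /L scaler_sumr -big_split; apply: eq_bigr => i _ /=.
  by rewrite !mxE mulrDl [_ *: _]mulrA.
pose LL := HB.pack_for {linear 'rV[R]_d -> R} L
  (GRing.isLinear.Build _ _ _ _ _ L_linear).
have L_cont : continuous LL.
  move=> h; have -> : (LL : 'rV[R]_d -> R) =
      \sum_i (fun h : 'rV[R]_d => h 0 i * 'D_'e_i f x).
    by apply/funext => u; rewrite fct_sumE.
  elim/big_ind : _ => [|u v cu cv|i _]; first exact: cst_continuous.
    exact: (continuousD cu cv).
  apply: (@cvgM _ _ (nbhs h) _ (fun w : 'rV[R]_d => w 0 i)).
    exact: coord_continuous.
  exact: cvg_cst.
have fE : f \o shift x = cst (f x) + (LL : 'rV[R]_d -> R) +o_ (0 : 'rV[R]_d) id.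
  apply/eqaddoP => e e0.
  (* The increment bound loses a factor [d]; dividing by [d.+1] absorbs it and stays meaningful when
     [d = 0]. *)
  have e1 : 0 < e / d.+1%:R by rewrite divr_gt0.
  have [r r0 near_x] : exists2 r : R, 0 < r & forall (i : 'I_d) y,
      `|y - x| < r -> derivable f y 'e_i /\
      `|'D_'e_i f y - 'D_'e_i f x| <= e / d.+1%:R.
    apply: (@near_forall_norm _ _ (fun i y => derivable f y 'e_i /\
      `|'D_'e_i f y - 'D_'e_i f x| <= e / d.+1%:R)) => i.
    near=> y; split; near: y; first exact: df.
    by have /cvgrPdistC_le/(_ _ e1) := cdf i.
  have r_near := @nbhs0_lt R 'rV[R]_d r r0.
  near=> h.
  have hr : `|h| < r.
    near: h; exact: r_near.
  have := partial_increment_bound near_x hr.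
  have -> : f (x + h) - f x - \sum_i h 0 i * 'D_'e_i f x =
      (f \o shift x - (cst (f x) + L)) h.
    by rewrite !fctE /= /L opprD addrA [h + x]addrC.
  move=> /le_trans; apply.
  rewrite ler_wpM2r// -mulrA ger_pMr// mulrC ler_pdivrMr// mul1r.
  by rewrite ler_nat.
have dE := diff_unique L_cont fE.
apply/diff_locallyP; rewrite dE; split => //.
Unshelve. all: by end_near. Qed.

Lemma derive_row f x v : differentiable f x ->
  'D_v f x = \sum_i v 0 i * 'D_'e_i f x.
Proof.
move=> df; rewrite deriveE// {1}(row_sum_delta v) linear_sum.
by apply: eq_bigr => i _; rewrite linearZ deriveE.
Qed.

Lemma Ck_continuous k U f x : Ck k U f -> U x -> {for x, continuous f}.
Proof. by case: k => [|k] [cf _]; exact: cf. Qed.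

Lemma CkS_derivable k U f x i : Ck k.+1 U f -> U x -> derivable f x 'e_i.
Proof. by case=> _ /(_ i)[+ _]; apply. Qed.

Lemma CkS_derive k U f i : Ck k.+1 U f -> Ck k U (fun x => 'D_'e_i f x).
Proof. by case=> _ /(_ i)[]. Qed.

Lemma CkW k U f : Ck k.+1 U f -> Ck k U f.
Proof.
elim: k f => [|k IH] f [cf df]; first by split.
by split => // i; have [dfi Cf] := df i; split => //; exact: IH.
Qed.

Lemma CkS_differentiable k U f x : open U -> Ck k.+1 U f -> U x ->
  differentiable f x.
Proof.
move=> oU cf Ux; apply: differentiable_partial => i.
  near=> y; apply: CkS_derivable cf _; near: y; exact: open_nbhs_nbhs.
exact: Ck_continuous (CkS_derive i cf) Ux.
Unshelve. all: by end_near. Qed.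

(** As [U] is open, functions equal on [U] are equal near each of its points, so the equality passes
    to derivatives of every order. *)
Lemma eq_Ck k U f g : open U -> {in U, f =1 g} -> Ck k U f -> Ck k U g.
Proof.
move=> oU; have near_eq f' g' x : {in U, f' =1 g'} -> U x -> \near x, f' x = g' x.
  move=> fg Ux; near=> y; apply/fg; rewrite inE; near: y; exact: open_nbhs_nbhs.
elim: k f g => [|k IH] f g fg [cf df]; split=> //.
- by move=> x Ux; apply: near_eq_continuous (cf x Ux); exact: near_eq.
- by move=> x Ux; apply: near_eq_continuous (cf x Ux); exact: near_eq.
- move=> i; have [dfi cdf] := df i; split=> [x Ux|].
    by apply: near_eq_derivable (dfi x Ux); exact: near_eq.
  apply: IH cdf => x /[1!inE] Ux.
  by apply: near_eq_derive; exact: near_eq.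
Unshelve. all: by end_near. Qed.

Lemma deriveDZ f g (c : R) x v : derivable f x v -> derivable g x v ->
  'D_v (f + c \*: g) x = 'D_v f x + c * 'D_v g x.
Proof. by move=> df dg; rewrite deriveD ?deriveZ//; exact: derivableZ. Qed.

Lemma CkDZ k U f g (c : R) : open U -> Ck k U f -> Ck k U g ->
  Ck k U (f + c \*: g).
Proof.
move=> oU; elim: k f g => [|k IH] f g Cf Cg; split=> //.
- move=> x Ux; apply: continuousD; first exact: Ck_continuous Cf Ux.
  apply: continuousM; [exact: cst_continuous|exact: Ck_continuous Cg Ux].
- move=> x Ux; apply: continuousD; first exact: Ck_continuous Cf Ux.
  apply: continuousM; [exact: cst_continuous|exact: Ck_continuous Cg Ux].
move=> i; split=> [x Ux|].
  apply: derivableD; first exact: CkS_derivable Cf Ux.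
  apply: derivableZ; exact: CkS_derivable Cg Ux.
apply: eq_Ck (IH _ _ (CkS_derive i Cf) (CkS_derive i Cg)) => // x /[1!inE] Ux.
have dg := @CkS_derivable _ _ _ _ i Cg Ux.
rewrite deriveD ?deriveZ//; first exact: CkS_derivable Cf Ux.
exact: derivableZ.
Qed.

Lemma Ck1_deriveDZ U f g (c : R) x i : Ck 1 U f -> Ck 1 U g -> U x ->
  'D_'e_i (f + c \*: g) x = 'D_'e_i f x + c * 'D_'e_i g x.
Proof.
move=> Cf Cg Ux; apply: deriveDZ; first exact: CkS_derivable Cf Ux.
exact: CkS_derivable Cg Ux.
Qed.

Lemma Ck2_deriveDZ U f g (c : R) x i j : open U -> Ck 2 U f -> Ck 2 U g -> U x ->
  'D_'e_i ('D_'e_j (f + c \*: g)) x =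
    'D_'e_i ('D_'e_j f) x + c * 'D_'e_i ('D_'e_j g) x.
Proof.
move=> oU Cf Cg Ux.
rewrite -(Ck1_deriveDZ c i (CkS_derive j Cf) (CkS_derive j Cg) Ux).
apply: near_eq_derive; near=> y; have Uy : U y.
  by near: y; exact: open_nbhs_nbhs.
by apply: deriveDZ; [exact: CkS_derivable Cf Uy|exact: CkS_derivable Cg Uy].
Unshelve. all: by end_near. Qed.

(** If [q > 0], then [dg], which vanishes at 0, is positive just to the right of 0, and the mean
    value theorem makes [g] exceed [g 0] there. *)
Lemma second_derivative_at_max (g dg : R -> R) (q : R) :
  (\forall s \near (0 : R), is_derive (s : R) 1 g (dg s)) ->
  is_derive (0 : R) 1 dg q -> (forall s, g s <= g 0) -> dg 0 = 0 /\ q <= 0.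
Proof.
move=> /nbhs_ballP[r /= r0 gr] [ddg qE] gmax.
have g_der (s : R) : `|s| < r -> is_derive s 1 g (dg s).
  by move=> sr; apply: gr; rewrite /ball/= sub0r normrN.
have dg0 : dg 0 = 0.
  have [_ <-] : is_derive (0 : R) 1 g (dg 0) by apply: g_der; rewrite normr0.
  have [||||//] := @derive1_at_max _ g (- r) r 0.
  - by rewrite ge0_cp// ltW.
  - move=> t; rewrite in_itv/= => /andP[t1 t2].
    by have [] := g_der t _; rewrite ?ltr_norml ?t1.
  - by rewrite in_itv/= oppr_lt0 r0.
  - by move=> t _.
split=> //; rewrite leNgt; apply/negP => q0.
have /cvgrPdist_lt/(_ _ q0) : (fun h : R => h^-1 *: (dg h - dg 0)) @ 0^' --> q.
  move: ddg; rewrite -qE /derive /derivable.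
  suff -> : (fun h : R => h^-1 *: ((dg \o shift 0) (h *: 1) - dg 0)) =
    (fun h : R => h^-1 *: (dg h - dg 0)) by [].
  by apply/funext => h /=; rewrite [h *: 1]mulr1 addr0.
rewrite near_withinE => /nbhs_ballP[r' /= r'0 qr].
have dg_gt0 s : 0 < s -> s < r' -> 0 < dg s.
  move=> s0 sr; have := qr s; rewrite /ball/= sub0r normrN gtr0_norm// gt_eqF//.
  move=> /(_ sr isT) /ltr_normlP[_]; rewrite dg0 subr0 ltrBlDr -ltrBlDl subrr.
  by rewrite pmulr_rgt0// invr_gt0.
(* Halving keeps [h] strictly inside both radii: the one where [dg] is the derivative of [g] and the
   one where [dg] is positive. *)
pose h := Num.min (r / 2) (r' / 2).
have h0 : 0 < h by rewrite lt_min !divr_gt0.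
have hr : h < r by rewrite gt_min ltr_pdivrMr// ltr_pMr// ltr1n.
have hr' : h < r' by rewrite gt_min [X in _ || X]ltr_pdivrMr// ltr_pMr// ltr1n orbT.
have [|| c] := @MVT _ g dg 0 h h0.
- move=> s; rewrite in_itv/= => /andP[s0 sh]; apply: g_der.
  by rewrite gtr0_norm//; exact: lt_trans hr.
- apply: derivable_within_continuous => s; rewrite in_itv/= => /andP[s0 sh].
  by have [] := g_der s _ => //; rewrite ger0_norm//; exact: le_lt_trans hr.
rewrite in_itv/= => /andP[c0 ch] gE.
have := gmax h; rewrite -subr_le0 gE subr0 leNgt mulr_gt0//.
by apply: dg_gt0 => //; exact: lt_trans hr'.
Qed.

(** The one-variable test is applied to the restriction of [f] to each line through [x]. *)
Lemma derivative_test_at_max U f x : open U -> Ck 2 U f -> U x ->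
  (forall y, f y <= f x) ->
  (forall i, 'D_'e_i f x = 0) /\
  forall v : 'rV[R]_d, \sum_i \sum_j v 0 i * v 0 j * 'D_'e_i ('D_'e_j f) x <= 0.
Proof.
move=> oU Cf Ux fmax.
(* On [U] this is the derivative of [f] along [v]; in this form it is visibly differentiable once
   more. *)
pose k v : 'rV[R]_d -> R := \sum_j v 0 j \*: 'D_'e_j f.
have kE v y : U y -> 'D_v f y = k v y.
  move=> Uy; rewrite derive_row; last exact: CkS_differentiable Cf Uy.
  by rewrite /k fct_sumE.
have dDf j : differentiable ('D_'e_j f) x.
  exact: CkS_differentiable oU (CkS_derive j Cf) Ux.
have dk v : differentiable (k v) x.
  by apply: differentiable_sum => j; exact: differentiableZ.
have test v : k v x = 0 /\ 'D_v (k v) x <= 0.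
  have := @second_derivative_at_max (fun s => f (x + s *: v))
    (fun s => k v (x + s *: v)) ('D_v (k v) x).
  rewrite scale0r addr0; apply.
  - have : \forall s \near (0 : R), U (x + s *: v).
      have : (fun s : R => x + s *: v) @ (0 : R) --> x + (0 : R) *: v.
        apply: cvgD; first exact: cvg_cst.
        by apply: cvgZr_tmp; exact: cvg_id.
      by apply; rewrite scale0r addr0; exact: open_nbhs_nbhs.
    apply: filterS => s Us; rewrite -kE//; apply: is_derive_line.
    by apply: diff_derivable; exact: CkS_differentiable Cf Us.
  - have := @is_derive_line _ _ (k v) x v 0; rewrite scale0r addr0; apply.
    exact: diff_derivable.
  - by move=> s; exact: fmax.
split=> [i|v].
  have [+ _] := test 'e_i; rewrite -kE//.
suff <- : 'D_v (k v) x = \sum_i \sum_j v 0 i * v 0 j * 'D_'e_i ('D_'e_j f) x.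
  by have [] := test v.
rewrite derive_row//; apply: eq_bigr => i _.
have ddf j : derivable ('D_'e_j f) x 'e_i by exact: diff_derivable.
rewrite /k derive_sum => [|j]; last exact: derivableZ.
by rewrite mulr_sumr; apply: eq_bigr => j _; rewrite deriveZ//= mulrA.
Qed.

End Calculus.

(** * Positive definite matrices *)

Section PositiveDefinite.
Variable R : realFieldType.

Definition posdefmx n (G : 'M[R]_n) : Prop :=
  G^T = G /\ forall v : 'rV[R]_n, v != 0 -> 0 < (v *m G *m v^T) 0 0.

Definition schur_compl n (a : R) (b : 'rV[R]_n) (C : 'M[R]_n) : 'M[R]_n :=
  C - a^-1 *: (b^T *m b).

(** The form of the Schur complement at [x] is the form of [G] at [(t, x)] for a suitable [t]. This
    drives the inductions on the size below. *)
Lemma posdefmx_block n (G : 'M[R]_(1 + n)) : posdefmx G ->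
  exists a b C, [/\ G = block_mx a%:M b b^T C, 0 < a &
    posdefmx (schur_compl a b C)].
Proof.
move=> [Gsym Gpos].
pose a := ulsubmx G 0 0; pose b := ursubmx G; pose C := drsubmx G.
have GE : G = block_mx a%:M b b^T C.
  by rewrite -mx11_scalar trmx_ursub Gsym submxK.
have a_gt0 : 0 < a.
  have /Gpos : (row_mx 1%:M 0 : 'rV[R]_(1 + n)) != 0.
    by rewrite row_mx_eq0 negb_and oner_eq0.
  rewrite GE mul_row_block tr_row_mx mul_row_col !mul1mx !mul0mx trmx0 mulmx0.
  by rewrite !addr0 trmx1 mulmx1 mxE eqxx.
have Csym : C^T = C by rewrite trmx_drsub Gsym.
exists a, b, C; split => //; split.
  by rewrite /schur_compl linearB linearZ /= trmx_mul trmxK Csym.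
move=> x x0.
(* This [t] kills the first entry of [(t, x) *m G]; it minimises the form in the first
   coordinate. *)
pose t := - a^-1 *: (x *m b^T).
have /Gpos : (row_mx t x : 'rV[R]_(1 + n)) != 0.
  by rewrite row_mx_eq0 negb_and x0 orbT.
rewrite GE mul_row_block tr_row_mx mul_row_col.
have -> : t *m a%:M + x *m b^T = 0.
  by rewrite mul_mx_scalar /t scalerA mulrN divff ?gt_eqF// scaleN1r addNr.
rewrite mul0mx add0r /schur_compl mulmxBr addrC /t -scalemxAl -scalemxAr.
by rewrite scaleNr mulmxA.
Qed.

(** A column operation of determinant 1 clears [b], so the determinant is [a] times that of the
    Schur complement. *)
Lemma posdefmx_det_gt0 n (G : 'M[R]_n) : posdefmx G -> 0 < \det G.
Proof.
elim: n G => [|n IH] G; first by rewrite det_mx00.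
move=> /(@posdefmx_block n)[a [b [C [-> a_gt0 /IH S_gt0]]]].
have : block_mx a%:M b b^T C *m block_mx 1%:M (- a^-1 *: b) 0 1%:M =
    block_mx a%:M 0 b^T (schur_compl a b C).
  rewrite mulmx_block !mulmx1 !mulmx0 !addr0 mul_scalar_mx scalerA mulrN.
  rewrite divff ?gt_eqF// scaleN1r addNr -scalemxAr scaleNr addrC.
  by [].
move=> /(congr1 determinant); rewrite det_mulmx det_ublock det_lblock !det1.
by rewrite !mulr1 det_scalar1 => ->; rewrite mulr_gt0.
Qed.

Lemma posdefmx_unit n (G : 'M[R]_n) : posdefmx G -> G \in unitmx.
Proof. by move=> /posdefmx_det_gt0 G0; rewrite unitmxE unitfE gt_eqF. Qed.

(** The form of [invmx G] at [v] is the form of [G] at [v *m invmx G]. *)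
Lemma posdefmx_inv n (G : 'M[R]_n) : posdefmx G -> posdefmx (invmx G).
Proof.
move=> Gpd; have Gu := posdefmx_unit Gpd; case: Gpd => Gsym Gpos; split.
  by rewrite trmx_inv Gsym.
move=> v v0; have /Gpos : v *m invmx G != 0.
  by apply: contra v0 => /eqP v0; rewrite -(mulmxKV Gu v) v0 mul0mx.
by rewrite mulmxKV// trmx_mul trmx_inv Gsym mulmxA.
Qed.

(* One rank-one term is peeled off at each step:
   [G = a^-1 w^T w + diag(0, schur_compl a b C)] with [w = (a, b)]. *)
Lemma mxtrace_posdef_le0 n (G H : 'M[R]_n) : posdefmx G ->
  (forall v : 'rV[R]_n, (v *m H *m v^T) 0 0 <= 0) -> \tr (G *m H) <= 0.
Proof.
elim: n G H => [|n IH]; first by move=> G H; rewrite thinmx0 mul0mx mxtrace0.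
rewrite -[n.+1]/(1 + n)%N => G H.
move=> /(@posdefmx_block n)[a [b [C [-> a_gt0 Spd]]]] Hneg.
pose w : 'rV[R]_(1 + n) := row_mx a%:M b.
have -> : block_mx a%:M b b^T C =
    a^-1 *: (w^T *m w) + block_mx 0 0 0 (schur_compl a b C).
  rewrite /w tr_row_mx mul_col_row tr_scalar_mx scale_block_mx add_block_mx.
  rewrite !addr0 /schur_compl addrC subrK -scalar_mxM mul_scalar_mx mul_mx_scalar.
  by rewrite scale_scalar_mx !scalerA mulKf ?mulVf ?gt_eqF// !scale1r.
rewrite mulmxDl linearD /= -[X in _ + \tr (_ *m X)]submxK mulmx_block.
rewrite !mul0mx !add0r mxtrace_block mxtrace0 add0r; apply: ler_wnDr.
  apply: IH => // x; have := Hneg (row_mx 0 x).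
  rewrite -{1}[H]submxK mul_row_block tr_row_mx mul_row_col.
  by rewrite !mul0mx trmx0 mulmx0 !add0r.
rewrite -scalemxAl linearZ /= -mulmxA mxtrace_mulC trace_mx11.
by rewrite mulr_ge0_le0// ?invr_ge0// ltW.
Qed.

End PositiveDefinite.

(** * The Laplacian *)

Section DifferentiableMatrix.
Variables (R : realType) (V : normedModType R).

Lemma differentiable_bigsum (I : Type) (r : seq I) (F : I -> V -> R) (x : V) :
  (forall i, differentiable (F i) x) ->
  differentiable (fun y => \sum_(i <- r) F i y) x.
Proof.
move=> dF; elim: r => [|i r IH].
  by under eq_fun do rewrite big_nil; exact: differentiable_cst.
by under eq_fun do rewrite big_cons; exact: differentiableD.
Qed.

Lemma differentiable_bigprod (I : Type) (r : seq I) (F : I -> V -> R) (x : V) :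
  (forall i, differentiable (F i) x) ->
  differentiable (fun y => \prod_(i <- r) F i y) x.
Proof.
move=> dF; elim: r => [|i r IH].
  by under eq_fun do rewrite big_nil; exact: differentiable_cst.
by under eq_fun do rewrite big_cons; exact: differentiableM.
Qed.

Lemma differentiable_det n (A : V -> 'M[R]_n) (x : V) :
  (forall i j, differentiable (fun y => A y i j) x) ->
  differentiable (fun y => \det (A y)) x.
Proof.
move=> dA; apply: differentiable_bigsum => s.
apply: differentiableM; first exact: differentiable_cst.
exact: differentiable_bigprod.
Qed.

Lemma differentiable_adj n (A : V -> 'M[R]_n) (x : V) i j :
  (forall i j, differentiable (fun y => A y i j) x) ->
  differentiable (fun y => (\adj (A y)) i j) x.
Proof.
move=> dA; under eq_fun do rewrite mxE.
apply: differentiableM; first exact: differentiable_cst.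
apply: differentiable_det => k l.
by under eq_fun do rewrite !mxE.
Qed.

End DifferentiableMatrix.

Section Laplacian.
Variables (R : realType) (d : nat) (M : closedRiemannianManifold R d).
Implicit Types (a : chart_index M) (f g : M -> R) (x : 'rV[R]_d) (p : M).

Definition chart_cod a : set 'rV[R]_d := chart a @` chart_dom a.

Lemma chart_cod_at p : chart_cod (chart_at p) (chart (chart_at p) p).
Proof. by exists p => //; exact: chart_atP. Qed.

Lemma metric_posdefmx a x : chart_cod a x -> posdefmx (metric a x).
Proof. by move=> ax; split; [exact: metric_symmetric|exact: metric_posdef]. Qed.

Definition metric_volume a x : R := Num.sqrt (\det (metric a x)).

Definition metric_coef a (i j : 'I_d) x : R :=
  metric_volume a x * invmx (metric a x) i j.

Lemma metric_volume_gt0 a x : chart_cod a x -> 0 < metric_volume a x.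
Proof. by move=> /metric_posdefmx/posdefmx_det_gt0; rewrite sqrtr_gt0. Qed.

(** Cramer's rule: near [x] the metric is invertible and its inverse is the adjugate over the
    determinant, a rational expression in smooth entries. The square root is harmless because the
    determinant is positive. *)
Lemma metric_coef_derivable a i j x v : chart_cod a x ->
  derivable (metric_coef a i j) x v.
Proof.
move=> ax; have oU := @chart_cod_open _ _ M a.
have dg k l : differentiable (fun y => metric a y k l) x.
  exact: CkS_differentiable oU (metric_smooth a k l 1) ax.
have ddet := differentiable_det dg.
have det_gt0 := posdefmx_det_gt0 (metric_posdefmx ax).
apply: (@near_eq_derivable _ _ _ (fun y => Num.sqrt (\det (metric a y)) *
  ((\det (metric a y))^-1 * \adj (metric a y) i j))).
  near=> y; have /metric_posdefmx/posdefmx_unit gu : chart_cod a y.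
    by near: y; exact: open_nbhs_nbhs.
  by rewrite /metric_coef /invmx gu [in RHS]mxE.
apply: diff_derivable; apply: differentiableM.
  apply: (@differentiable_comp _ _ _ _ (fun y => \det (metric a y)) Num.sqrt) => //.
  by apply/derivable1_diffP; have [] := is_derive1_sqrt det_gt0.
apply: differentiableM; last exact: differentiable_adj.
by apply: differentiableV => //; rewrite gt_eqF.
Unshelve. all: by end_near. Qed.

Definition in_chart a f : 'rV[R]_d -> R := fun x => f (chart_inv a x).

(** The product rule separates the second-order part from the first-order part, which vanishes at a
    critical point. *)
Lemma chart_laplacianE a f x : C2 f -> chart_cod a x ->
  chart_laplacian a f x = (metric_volume a x)^-1 * \sum_i \sum_j
    (metric_coef a i j x * 'D_'e_i ('D_'e_j (in_chart a f)) x +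
     'D_'e_j (in_chart a f) x * 'D_'e_i (metric_coef a i j) x).
Proof.
move=> f2 ax; have oU := @chart_cod_open _ _ M a.
rewrite /chart_laplacian; congr (_ * _); apply: eq_bigr => i _.
have dDf j : derivable ('D_'e_j (in_chart a f)) x 'e_i.
  exact: CkS_derivable (CkS_derive j (f2 a)) ax.
rewrite (_ : (fun y => _) = \sum_j metric_coef a i j \* 'D_'e_j (in_chart a f)).
  rewrite derive_sum => [|j]; last first.
    by apply: derivableM => //; exact: metric_coef_derivable.
  apply: eq_bigr => j _; rewrite deriveM//; exact: metric_coef_derivable.
apply/funext => y; rewrite fct_sumE mulr_sumr; apply: eq_bigr => j _.
by rewrite mulrA.
Qed.

(** The free scalar lets one lemma serve three times: [c = 1] and [c = -1] for the two components of
    the anticonformal part, [c = -2] for negation. *)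
Lemma C2_combination f g (c : R) : C2 f -> C2 g -> C2 (fun q => f q + c * g q).
Proof.
by move=> f2 g2 a; exact: (CkDZ c (@chart_cod_open _ _ M a) (f2 a) (g2 a)).
Qed.

Lemma laplacian_combination f g (c : R) p : C2 f -> C2 g ->
  laplacian (fun q => f q + c * g q) p = laplacian f p + c * laplacian g p.
Proof.
move=> f2 g2; have ax := chart_cod_at p.
have distr (k t u v u' v' : R) : k * (u + c * u') + (v + c * v') * t =
    k * u + v * t + c * (k * u' + v' * t) by ring.
have fg2 := C2_combination c f2 g2.
rewrite /laplacian; set a := chart_at p in ax *; set x := chart a p in ax *.
have oU := @chart_cod_open _ _ M a.
rewrite !chart_laplacianE//.
have -> : in_chart a (fun q => f q + c * g q) = in_chart a f + c \*: in_chart a g.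
  by [].
rewrite mulrCA -mulrDr; congr (_ * _).
rewrite mulr_sumr -big_split; apply: eq_bigr => i _ /=.
rewrite mulr_sumr -big_split; apply: eq_bigr => j _ /=.
rewrite (Ck2_deriveDZ c i j oU (f2 a) (g2 a) ax).
rewrite (Ck1_deriveDZ c j (CkW (f2 a)) (CkW (g2 a)) ax).
exact: distr.
Qed.

(** At a maximum the gradient vanishes and the volume factors cancel. What remains is the trace of a
    positive definite matrix times a negative semidefinite Hessian. *)
Lemma laplacian_at_max f p : C2 f -> (forall q, f q <= f p) -> laplacian f p <= 0.
Proof.
move=> f2 fmax; have ax := chart_cod_at p.
rewrite /laplacian; set a := chart_at p in ax *; set x := chart a p in ax *.
have [|Df0 hess] := derivative_test_at_max (@chart_cod_open _ _ M a) (f2 a) ax.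
  (* [chart_inv] takes values in [M] even outside the image of the chart, so the global maximum of
     [f] bounds its chart expression everywhere. *)
  by move=> y; rewrite [leRHS](_ : _ = f p) ?chartK//; exact: chart_atP.
rewrite chart_laplacianE// /metric_coef.
under eq_bigr do under eq_bigr do rewrite Df0 mul0r addr0 -mulrA.
under eq_bigr do rewrite -mulr_sumr.
rewrite -mulr_sumr mulKf ?gt_eqF ?metric_volume_gt0//.
pose H : 'M[R]_d := \matrix_(i, j) 'D_'e_j ('D_'e_i (in_chart a f)) x.
have -> : \sum_i \sum_j
      invmx (metric a x) i j * 'D_'e_i ('D_'e_j (in_chart a f)) x =
    \tr (invmx (metric a x) *m H).
  by apply: eq_bigr => i _; rewrite mxE; apply: eq_bigr => j _; rewrite mxE.
apply: mxtrace_posdef_le0; first exact/posdefmx_inv/metric_posdefmx.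
move=> v; apply: le_trans (hess v); rewrite le_eqVlt; apply/orP; left; apply/eqP.
rewrite mxE; apply: eq_bigr => i _; rewrite mxE mulr_suml.
by apply: eq_bigr => j _; rewrite !mxE /in_chart; ring.
Qed.

End Laplacian.

(** * The maximum principle *)

Section MaximumPrinciple.
Variable R : realType.

(** Maximality reads [w (t + h) <= w t * expR (K * h)] for [h < 0]; dividing by [h] reverses the
    inequality, and [h] tends to 0. Only earlier times are compared, since the maximum may sit at
    the end of the time interval. *)
Lemma time_derivative_at_max (w : R -> R) (t K l : R) : 0 < t ->
  (fun h => h^-1 * (w (t + h) - w t)) @ within [set h | 0 <= t + h] 0^' --> l ->
  (forall s, 0 <= s <= t -> w s * expR (- (K * s)) <= w t * expR (- (K * t))) ->
  w t * K <= l.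
Proof.
move=> t0 dw wmax.
have near_t : \forall h \near (0 : R), - t < h.
  by apply: lt_nbhsr; rewrite oppr_lt0.
(* As [t > 0], small negative increments stay at nonnegative times. *)
have left_sub : (0 : R)^'- --> within [set h | 0 <= t + h] (0 : R)^'.
  move=> P HP.
  have {}HP : \forall h \near (0 : R), h != 0 -> 0 <= t + h -> P h := HP.
  change (\forall h \near (0 : R), h < 0 -> P h).
  near=> h => h0; have : - t < h by near: h.
  rewrite -subr_gt0 opprK addrC => /ltW.
  have : h != 0 by rewrite lt_eqF.
  by near: h.
have {}dw : (fun h => h^-1 * (w (t + h) - w t)) @ (0 : R)^'- --> l.
  exact: cvg_trans (cvg_app _ left_sub) dw.
have dexp : (fun h => w t * (h^-1 * (expR (K * h) - 1))) @ (0 : R)^'- --> w t * K.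
  apply: cvgM; first exact: cvg_cst.
  have [dE DE] : is_derive (0 : R) 1 (fun h => expR (K * h)) K.
    have dK : is_derive (0 : R) 1 (K \*: (id : R -> R)) (K *: (1 : R)).
      exact: is_deriveZ.
    have := is_derive1_comp (is_derive_expR (K * 0)) dK.
    by rewrite /= mulr0 expR0 mul1r [K *: 1]mulr1.
  have := dE; rewrite /derivable -/('D_1 (fun h => expR (K * h)) 0) DE.
  move=> /cvg_dnbhs_at_left; apply: cvg_trans; apply: near_eq_cvg; near=> h.
  by rewrite /= mulr0 expR0 addr0 [h *: 1]mulr1.
apply: ler_cvg_to dexp dw _; near=> h.
have h0 : h < 0 by [].
have : - t < h by near: h; exact: cvg_within near_t.
move=> th.
rewrite mulrCA ler_nM2l ?invr_lt0// mulrBr mulr1 lerBlDr subrK.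
have /wmax : 0 <= t + h <= t by rewrite gerDl (ltW h0) addrC -lerBlDr sub0r ltW.
rewrite -ler_pdivlMr ?expR_gt0// -expRN -mulrA -expRD => /le_trans; apply.
by rewrite opprK mulrDr addrA addNr add0r.
Unshelve. all: by end_near. Qed.

Variables (d : nat) (M : closedRiemannianManifold R d).

(** The differential inequality is asked only where [w > 0]: there a zeroth-order coefficient at
    most [k] may be replaced by [k], however negative it is. *)
Theorem parabolic_maximum_principle (w : R -> M -> R) (k : R) :
  {within [set z : R * M | 0 <= z.1], continuous (fun z => w z.1 z.2)} ->
  (forall t, 0 < t -> C2 (w t)) ->
  (forall p, w 0 p <= 0) ->
  (forall t p, 0 < t -> 0 < w t p ->
    exists2 l, l <= laplacian (w t) p + k * w t p &
    (fun h => h^-1 * (w (t + h) p - w t p))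
      @ within [set h | 0 <= t + h] 0^' --> l) ->
  forall t p, 0 <= t -> w t p <= 0.
Proof.
move=> cw w2 w0 dw T p1 T0; rewrite leNgt; apply/negP => wT.
(* Maximize [e^(-(k+1)t) w] over [0, T] x M: at a positive maximum, the time
   derivative is at least [(k+1) w] while the Laplacian is nonpositive. *)
pose K := k + 1.
pose v (z : R * M) := w z.1 z.2 * expR (- (K * z.1)).
pose A : set (R * M) := `[0, T]%classic `*` [set: M].
have cA : compact A.
  by apply: compact_setX; [exact: segment_compact|exact: carrier_compact].
have cv : {within A, continuous v}.
  have cexp : continuous (fun z : R * M => expR (- (K * z.1))).
    move=> z; apply: (@cvg_comp _ _ _ (fun z : R * M => - (K * z.1)) expR).
      by apply: cvgN; apply: cvgM; [exact: cvg_cst|exact: cvg_fst].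
    exact: continuous_expR.
  have {}cw : {within A, continuous (fun z : R * M => w z.1 z.2)}.
    apply: continuous_subspaceW cw => -[s q] /= [+ _].
    by rewrite /= in_itv/= => /andP[].
  by move=> z; apply: (cvgM (cw z)); exact: continuous_subspaceT.
have AT : A (T, p1) by split => //=; rewrite in_itv/= T0 lexx.
have [|[t0 p0] /set_mem[/= t0T _] vmax] := compact_EVT_max _ cA cv.
  by exists (T, p1).
have {}vmax s q : 0 <= s <= T ->
    w s q * expR (- (K * s)) <= w t0 p0 * expR (- (K * t0)).
  by move=> sT; apply: (vmax (s, q)); apply/mem_set; split => //=; rewrite in_itv.
move: t0T; rewrite in_itv/= => /andP[t0_ge0 t0T].
have wt0 : 0 < w t0 p0.
  rewrite -(@pmulr_lgt0 _ (expR (- (K * t0)))) ?expR_gt0//.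
  by apply: lt_le_trans (vmax T p1 _); rewrite ?T0 ?lexx// mulr_gt0// expR_gt0.
have t0_gt0 : 0 < t0.
  rewrite lt_neqAle t0_ge0 andbT; apply/eqP => t0E.
  by move: wt0; rewrite -t0E ltNge w0.
have [l lw dl] := dw _ _ t0_gt0 wt0.
have lap : laplacian (w t0) p0 <= 0.
  apply: laplacian_at_max; first exact: w2.
  move=> q; rewrite -(@ler_pM2r _ (expR (- (K * t0)))) ?expR_gt0//.
  by apply: vmax; rewrite t0_ge0.
have : w t0 p0 * K <= l.
  apply: time_derivative_at_max (fun s => w s p0) _ _ _ t0_gt0 dl _ => s /andP[s0 st].
  by apply: vmax; rewrite s0 (le_trans st).
move=> /le_trans/(_ lw); rewrite /K => Kw.
suff : w t0 p0 <= 0 by rewrite leNgt wt0.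
lra.
Qed.

End MaximumPrinciple.

(** * Uniqueness for linear scalar parabolic equations *)

Section Uniqueness.
Variables (R : realType) (d : nat) (M : closedRiemannianManifold R d).

(** The maximum principle is applied to [w] and to [- w], which solve the same linear equation. *)
Lemma linear_parabolic_eq0 (w q : R -> M -> R) (k : R) :
  {within [set z : R * M | 0 <= z.1], continuous (fun z => w z.1 z.2)} ->
  (forall t, 0 < t -> C2 (w t)) ->
  (forall p, w 0 p = 0) ->
  (forall t p, q t p <= k) ->
  (forall t p, 0 < t -> (fun h => h^-1 * (w (t + h) p - w t p))
    @ within [set h | 0 <= t + h] 0^' --> laplacian (w t) p + q t p * w t p) ->
  forall t p, 0 <= t -> w t p = 0.
Proof.
move=> cw w2 w0 qk dw t p t0; apply/eqP; rewrite eq_le; apply/andP; split.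
  apply: (parabolic_maximum_principle (k := k) cw w2 _ _ _ t0) => [r|s r s0 w_gt0].
    by rewrite w0.
  exists (laplacian (w s) r + q s r * w s r); last exact: dw.
  by rewrite lerD2l ler_wpM2r ?(ltW w_gt0).
(* [- w] is written [w + -2 * w] to reuse the lemmas on linear combinations *)
have [c cE] : {c : R | c = - 2} by exists (- 2).
have : w t p + c * w t p <= 0; last by rewrite cE => ?; lra.
move: t p t0; apply: (@parabolic_maximum_principle _ _ _
  (fun s r => w s r + c * w s r) k).
- move=> z; apply: cvgD; first exact: cw.
  by apply: cvgM; [exact: cvg_cst|exact: cw].
- by move=> s s0; apply: C2_combination; exact: w2.
- by move=> r; rewrite w0 mulr0 addr0.
move=> s r s0 w_lt0.
exists (- (laplacian (w s) r + q s r * w s r)).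
  rewrite (laplacian_combination c r (w2 s s0) (w2 s s0)).
  have : 0 <= (k - q s r) * (w s r + c * w s r).
    by rewrite mulr_ge0// ?subr_ge0// ltW.
  by rewrite cE => ?; lra.
rewrite (_ : (fun h => _) = (fun h => - (h^-1 * (w (s + h) r - w s r)))).
  exact: cvgN (dw s r s0).
by apply/funext => h; rewrite cE; ring.
Qed.

End Uniqueness.

(** * Anticonformal parts *)

Section TwoByTwo.
Variable R : realType.

Lemma col_continuous m n (j : 'I_n) :
  continuous (col j : 'M[R]_(m, n) -> 'cV[R]_m).
Proof.
move=> B S /nbhs_ballP[e /= e0 eS]; apply/nbhs_ballP; exists e => //= C [_ BC].
by apply: eS; split => // i k; rewrite !mxE; exact: BC.
Qed.

Lemma sum_I2 (F : 'I_2 -> R) : \sum_i F i = F 0 + F 1.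
Proof. by rewrite big_ord_recl big_ord1; congr (_ + F _); exact: val_inj. Qed.

Lemma mx_reaction2E (eps : R) (A : 'M[R]_2) i j :
  mx_reaction eps A i j = - (eps ^- 2 *
    (A i 0 * (A 0 0 * A 0 j + A 1 0 * A 1 j - (0 == j)%:R) +
     A i 1 * (A 0 1 * A 0 j + A 1 1 * A 1 j - (1 == j)%:R))).
Proof. by rewrite !mxE sum_I2 !mxE !sum_I2 !mxE. Qed.

(* [eps^-2 (1 - |w|^2 - 3|z|^2)] for the matrix [v |-> z v + w (conj v)]. *)
Definition anticonformal_rate (eps : R) (A : 'M[R]_2) : R :=
  eps ^- 2 * (1 - (A 0 0 - A 1 1) ^+ 2 / 4 - (A 0 1 + A 1 0) ^+ 2 / 4 -
    3 * ((A 0 0 + A 1 1) ^+ 2 / 4 + (A 1 0 - A 0 1) ^+ 2 / 4)).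

Lemma anticonformal_rate_le (eps : R) (A : 'M[R]_2) :
  anticonformal_rate eps A <= eps ^- 2.
Proof.
apply: ler_piMr; first by rewrite invr_ge0 sqr_ge0.
have := sqr_ge0 (A 0 0 - A 1 1); have := sqr_ge0 (A 0 1 + A 1 0).
have := sqr_ge0 (A 0 0 + A 1 1); have := sqr_ge0 (A 1 0 - A 0 1).
lra.
Qed.

(** [A 0 0 - A 1 1] is twice the real part of [w], and the off-diagonal sum of the next lemma is
    twice its imaginary part; both have the same rate. *)
Lemma mx_reaction_diag (eps : R) (A : 'M[R]_2) :
  mx_reaction eps A 0 0 - mx_reaction eps A 1 1 =
  anticonformal_rate eps A * (A 0 0 - A 1 1).
Proof.
(* With [eps ^- 2] generalized, the only divisions left to [field] are by 4. *)
by rewrite !mx_reaction2E /anticonformal_rate /=; move: (eps ^- 2) => e; field.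
Qed.

Lemma mx_reaction_offdiag (eps : R) (A : 'M[R]_2) :
  mx_reaction eps A 0 1 + mx_reaction eps A 1 0 =
  anticonformal_rate eps A * (A 0 1 + A 1 0).
Proof.
by rewrite !mx_reaction2E /anticonformal_rate /=; move: (eps ^- 2) => e; field.
Qed.

(** The columns of a conformal matrix are orthogonal and of equal length, so [A^T *m A - 1%:M] is a
    scalar matrix. *)
Lemma mx_reaction_conformal (eps : R) (A : 'M[R]_2) :
  A 0 0 = A 1 1 -> A 0 1 = - A 1 0 ->
  col 0 (mx_reaction eps A) = GL_reaction eps (col 0 A).
Proof.
move=> A00 A01; apply/colP => i; rewrite mxE mx_reaction2E !mxE /enorm.
rewrite sqr_sqrtr sum_I2 ?addr_ge0 ?sqr_ge0// !mxE -A00 A01.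
have /orP[/eqP->|/eqP->] : (i == 0) || (i == 1) by case: i => -[|[|]].
  by rewrite A01 /=; ring.
by rewrite -A00 /=; ring.
Qed.

Lemma det_mx22 (A : 'M[R]_2) : \det A = A 0 0 * A 1 1 - A 0 1 * A 1 0.
Proof.
have l0 : lift (0 : 'I_2) (0 : 'I_1) = 1 by exact: val_inj.
have l1 : lift (1 : 'I_2) (0 : 'I_1) = 0 by exact: val_inj.
rewrite (expand_det_row A 0) sum_I2 /cofactor !det_mx11 !mxE l0 l1 /=.
by rewrite expr0 expr1 mul1r mulN1r mulrN.
Qed.

Lemma SO2_conformal (A : 'M[R]_2) : SO A -> A 0 0 = A 1 1 /\ A 0 1 = - A 1 0.
Proof.
move=> [/matrixP AA detA]; move: (AA 0 0) (AA 1 1) detA.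
rewrite det_mx22 !mxE !sum_I2 !mxE /= => n0 n1 detA.
suff [d0 o0] : A 0 0 - A 1 1 = 0 /\ A 0 1 + A 1 0 = 0.
  by split; lra.
(* This is the sum of the squares of all entries minus twice the determinant, that is, 2 - 2. *)
have : (A 0 0 - A 1 1) ^+ 2 + (A 0 1 + A 1 0) ^+ 2 = 0 by lra.
move=> /eqP; rewrite paddr_eq0 ?sqr_ge0// !sqrf_eq0 => /andP[/eqP -> /eqP ->].
by [].
Qed.

End TwoByTwo.

(* I = [0, +oo[ is the case of initial data regular enough for the equation to
   make sense at t = 0; I = ]0, +oo[ allows merely continuous initial data. *)
Theorem lemma1p3 (R : realType) (d : nat) (Omega : closedRiemannianManifold R d)
    (eps : R) (eps_gt0 : 0 < eps) (I : set R)
    (I_time : I = [set t | 0 <= t] \/ I = [set t | 0 < t])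
    (A0 : Omega -> 'M[R]_2) (A0_SO2 : forall x, SO (A0 x))
    (A : R -> Omega -> 'M[R]_2)
    (A_sol : classical_solution I (mx_reaction eps) A)
    (A_init : forall x, A 0 x = A0 x) :
  classical_solution I (GL_reaction eps) (fun t x => col 0 (A t x)).
Proof.
case: A_sol => cA A2 dA.
have I_gt0 t : 0 < t -> I t by case: I_time => -> //=; exact: ltW.
have I_ge0 t : I t -> 0 <= t by case: I_time => -> //=; exact: ltW.
have dA_entry t p i j : 0 < t ->
    (fun h => h^-1 * (A (t + h) p i j - A t p i j))
      @ within [set h | 0 <= t + h] 0^' -->
    laplacian (fun q => A t q i j) p + mx_reaction eps (A t p) i j.
  move=> /I_gt0/(dA t p)/(cvg_comp _ (fun B : 'M[R]_2 => B i j)).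
  rewrite /is_time_derivative => /(_ _ (@coord_continuous _ _ _ i j _)).
  rewrite !mxE; apply: cvg_trans; apply: near_eq_cvg; near=> h.
  by rewrite /= !mxE.
(* Both components of the anticonformal part have this shape, so one argument treats their linear
   equations. *)
have combination_eq0 i j k l (c : R) :
    (forall B, SO B -> B i j + c * B k l = 0) ->
    (forall B, mx_reaction eps B i j + c * mx_reaction eps B k l =
      anticonformal_rate eps B * (B i j + c * B k l)) ->
    forall t p, 0 <= t -> A t p i j + c * A t p k l = 0.
  move=> SO_eq0 reactionE.
  apply: (@linear_parabolic_eq0 _ _ _ (fun t p => A t p i j + c * A t p k l)
    (fun t p => anticonformal_rate eps (A t p)) (eps ^- 2)).
  - move=> z.
    have cAij i' j' := cvg_comp _ _ (cA z) (@coord_continuous _ _ _ i' j' _).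
    by apply: cvgD; [exact: cAij|apply: cvgM; [exact: cvg_cst|exact: cAij]].
  - by move=> t t0; apply: C2_combination; apply: A2; exact: I_gt0.
  - by move=> p; rewrite A_init SO_eq0.
  - by move=> t p; exact: anticonformal_rate_le.
  move=> t p t0; have It := I_gt0 _ t0.
  rewrite (laplacian_combination c p (A2 t It i j) (A2 t It k l)) -reactionE.
  rewrite addrACA -mulrDr.
  rewrite (_ : (fun h => _) = fun h => h^-1 * (A (t + h) p i j - A t p i j) +
      c * (h^-1 * (A (t + h) p k l - A t p k l))).
    exact: cvgD (dA_entry t p i j t0) (cvgM (cvg_cst c) (dA_entry t p k l t0)).
  by apply/funext => h; ring.
(* The diagonal entries are combined with [c = -1], the off-diagonal ones with [c = 1]. Time 0 is
   included, as [I] may contain it. *)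
have A_conformal t p : 0 <= t -> A t p 0 0 = A t p 1 1 /\ A t p 0 1 = - A t p 1 0.
  move=> t0; split.
    apply/subr0_eq; rewrite -mulN1r.
    apply: combination_eq0 => // [B /SO2_conformal[-> _]|B]; rewrite ?mulN1r ?subrr//.
    exact: mx_reaction_diag.
  apply/eqP; rewrite -addr_eq0 -[A t p 1 0]mul1r; apply/eqP.
  apply: combination_eq0 => // [B /SO2_conformal[_ ->]|B]; rewrite ?mul1r ?addNr//.
  exact: mx_reaction_offdiag.
split.
- by move=> z; exact: cvg_comp (cA z) (@col_continuous _ _ _ 0 _).
- move=> t It i j; rewrite (_ : (fun p => _) = (fun p => A t p i 0)); first exact: A2.
  by apply/funext => p; rewrite mxE.
move=> t p It; have [A00 A01] := A_conformal t p (I_ge0 t It).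
(* The Laplacian is entrywise, so it commutes with taking a column; conformality at [(t, p)] handles
   the reaction term. *)
have -> : mx_laplacian (fun q => col 0 (A t q)) p +
    GL_reaction eps (col 0 (A t p)) =
    col 0 (mx_laplacian (A t) p + mx_reaction eps (A t p)).
  rewrite linearD /= mx_reaction_conformal//; congr (_ + _).
  apply/matrixP => i j; rewrite !mxE; congr (laplacian _ p).
  by apply/funext => q; rewrite mxE.
rewrite /is_time_derivative (_ : (fun h => _) =
    col 0 \o (fun h => h^-1 *: (A (t + h) p - A t p))).
  exact: cvg_comp (dA t p It) (@col_continuous _ _ _ 0 _).
by apply/funext => h; apply/matrixP => i j; rewrite !mxE.
Unshelve. all: by end_near. Qed.
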